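(* For all integers $n\geq 0$, $\bar{B}_{8,3}(36n+33)\equiv 0 \pmod 3$.
   Context: An overpartition of a positive integer $n$ is a partition of $n$ in which the first occurrence of each distinct part may be overlined. For coprime integers $\ell_1,\ell_2>1$, $\bar{B}_{\ell_1,\ell_2}(n)$ denotes the number of overpartitions of $n$ in which no part is divisible by $\ell_1$ or by $\ell_2$, with $\bar{B}_{\ell_1,\ell_2}(0)=1$. *)

(* Defs.v *)
From mathcomp Require Import all_boot.

Set Implicit Arguments.
Unset Strict Implicit.
Unset Printing Implicit Defensive.

(* A partition with overlines is a list of pairs (part, overlined?), the parts
   being in nonincreasing order.  [index p ps] is the position of the first
   occurrence of [p] in [ps]. *)
Definition overpartition (n : nat) (s : seq (nat * bool)) : bool :=
  let parts := unzip1 s in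
  let overlined := unzip2 s in
  [&& sorted geq parts, 0 \notin parts, sumn parts == n &
      all (fun i => nth false overlined i ==> (index (nth 0 parts i) parts == i))
          (iota 0 (size s))].

Definition regular (l1 l2 : nat) (s : seq (nat * bool)) : bool :=
  all (fun p => ~~ (l1 %| p) && ~~ (l2 %| p)) (unzip1 s).

Definition oseq n (s : seq ('I_n.+1 * bool)) : seq (nat * bool) :=
  [seq (nat_of_ord x.1, x.2) | x <- s].

(* The parts of an overpartition of n are at most n, and there are at most n of
   them, so bounding both loses nothing (see [overpartition_bseq]); this only
   places the objects counted in a finite type. *)
Definition Bbar (l1 l2 n : nat) : nat :=
  #|[set s : {bseq n of 'I_n.+1 * bool} |
      overpartition n (oseq s) && regular l1 l2 (oseq s)]|.

Lemma oseq_inj n : injective (@oseq n).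
Proof. by apply: inj_map => -[i b] [j c] [/val_inj-> ->]. Qed.

Lemma overpartition_bseq n s :
  overpartition n s -> exists t : {bseq n of 'I_n.+1 * bool}, oseq t = s.
Proof.
case/and4P=> _ s_gt0 /eqP sum_s _.
have le_n : all (fun x => x.1 <= n) s.
  rewrite -sum_s; elim: s {s_gt0 sum_s} => //= -[p b] s IHs /=.
  rewrite leq_addr /=; apply: sub_all IHs => x /leq_trans; apply.
  exact: leq_addl.
have size_s : size s <= n.
  rewrite -sum_s; elim: s s_gt0 {sum_s le_n} => //= -[p b] s IHs /=.
  rewrite inE negb_or eq_sym -lt0n => /andP[p_gt0 /IHs le_s].
  by rewrite -add1n leq_add.
have size_t : size [seq (inord x.1 : 'I_n.+1, x.2) | x <- s] <= n.
  by rewrite size_map.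
exists (Bseq size_t); rewrite /oseq /= -map_comp.
elim: s le_n {s_gt0 sum_s size_s size_t} => //= -[p b] s IHs /= /andP[le_p /IHs->].
by rewrite inordK.
Qed.

Lemma Bbar0 l1 l2 : Bbar l1 l2 0 = 1.
Proof.
rewrite /Bbar -[RHS](cards1 ([bseq] : {bseq 0 of 'I_1 * bool})).
congr #|pred_of_set _|; apply/setP => s; rewrite !inE [s]bseq0.
by rewrite eqxx.
Qed.

(* Main.v *)
Require Import Defs.
From HB Require Import structures.
From mathcomp Require Import all_boot all_order all_algebra.
From mathcomp Require Import boolp.
From mathcomp Require Import ring zify.

Set Implicit Arguments.
Unset Strict Implicit.
Unset Printing Implicit Defensive.

Import GRing.Theory.
Local Open Scope ring_scope.

(**
Write x = phi(-q) = sum over k in Z of (-1)^k q^(k^2) and W = sum over k in Z of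
q^(k(k+1)).  Gauss's identity says that 1/x is the generating function of overpartitions, so
the generating function of Bbar 8 3 is x(q^8) x(q^3) / (x(q) x(q^24)), which over F_3
equals x(q)^2 / x(q^8)^2 because f(q^3) = f(q)^3.  From x(q) = y(q^4) - q W(q^4) and
x(q) y(q) = x(q^2)^2, where y(q) = x(-q), its coefficient of q^(4m+1) is -2 times the
coefficient of q^m in W/x; what remains is the case m = 9n+8.

The key congruence is x^4 = 1 + q W^4 mod 3: at each n > 0 it compares the two kinds of
Hurwitz quaternions of norm n (integral and half-integral), on which a unit of order 3 acts
freely.  Splitting k modulo 3 gives x = x^9 + q d^3 and W = a^3 + q^2 W^9 over F_3, and the
congruence then determines a^3 and d^3; expanding W/x = W x^2 / x^3, the part of W/x with
exponents 2 mod 3 is 2 q^2 (x W^3)^3.  Since x W^3 = (x^3 W)^3 + q (d W)^3 has no exponent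
2 mod 3, the coefficient of q^(9n+8) in W/x vanishes.
*)

(** * Formal power series *)

(** The record lets the Cauchy product be declared as the ring multiplication of this type. *)
Record series (R : Type) := Series { scoef :> nat -> R }.

Lemma seriesP (R : Type) (f g : series R) : f =1 g -> f = g.
Proof. by case: f g => f [g] /= /funext ->. Qed.

HB.instance Definition _ (R : Type) := gen_eqMixin (series R).
HB.instance Definition _ (R : Type) := gen_choiceMixin (series R).

Section SeriesRing.
Variable R : comNzRingType.
Implicit Types f g h : series R.

Definition szero : series R := Series (fun=> 0).
Definition sopp f := Series (fun n => - f n).
Definition sadd f g := Series (fun n => f n + g n).
Definition sone : series R := Series (fun n => (n == 0)%:R).
Definition smul f g := Series (fun n => \sum_(i < n.+1) f i * g (n - i)%N).

Fact saddA : associative sadd.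
Proof. by move=> f g h; apply/seriesP => n /=; rewrite addrA. Qed.
Fact saddC : commutative sadd.
Proof. by move=> f g; apply/seriesP => n /=; rewrite addrC. Qed.
Fact sadd0 : left_id szero sadd.
Proof. by move=> f; apply/seriesP => n /=; rewrite add0r. Qed.
Fact saddN : left_inverse szero sopp sadd.
Proof. by move=> f; apply/seriesP => n /=; rewrite addNr. Qed.

HB.instance Definition _ :=
  GRing.isZmodule.Build (series R) saddA saddC sadd0 saddN.

Definition trunc n f : {poly R} := \poly_(i < n.+1) f i.

Lemma coef_trunc n f i : (i <= n)%N -> (trunc n f)`_i = f i.
Proof. by move=> le_in; rewrite coef_poly ltnS le_in. Qed.

(** A coefficient of degree at most n only sees the truncations at n, so associativity and
    commutativity are inherited from polynomials. *)
Lemma smul_trunc n f g i : (i <= n)%N -> smul f g i = (trunc n f * trunc n g)`_i.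
Proof.
move=> le_in; rewrite coefM /=; apply: eq_bigr => j _.
by rewrite !coef_trunc //; have := ltn_ord j; lia.
Qed.

Fact smulA : associative smul.
Proof.
move=> f g h; apply/seriesP => n.
transitivity (trunc n f * (trunc n g * trunc n h))`_n.
  rewrite coefM; apply: eq_bigr => i _.
  by rewrite coef_trunc -?smul_trunc //; have := ltn_ord i; lia.
rewrite mulrA coefM; apply: eq_bigr => i _.
by rewrite coef_trunc -?smul_trunc //; have := ltn_ord i; lia.
Qed.
Fact smulC : commutative smul.
Proof. by move=> f g; apply/seriesP => n; rewrite !(smul_trunc _ _ (leqnn n)) mulrC. Qed.
Fact smul1 : left_id sone smul.
Proof.
move=> f; apply/seriesP => n /=; rewrite big_ord_recl /= mul1r subn0 big1 ?addr0 //.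
by move=> i _; rewrite mul0r.
Qed.
Fact smulDl : left_distributive smul sadd.
Proof.
move=> f g h; apply/seriesP => n /=; rewrite -big_split /=.
by apply: eq_bigr => i _; rewrite mulrDl.
Qed.
Fact sone_neq0 : sone != 0.
Proof. by apply/eqP => /(congr1 (fun f : series R => f 0)) /eqP; rewrite oner_eq0. Qed.

HB.instance Definition _ :=
  GRing.Zmodule_isComNzRing.Build (series R) smulA smulC smul1 smulDl sone_neq0.

Lemma coefsD f g n : (f + g) n = f n + g n. Proof. by []. Qed.
Lemma coefsN f n : (- f) n = - f n. Proof. by []. Qed.
Lemma coefsB f g n : (f - g) n = f n - g n. Proof. by []. Qed.
Lemma coefs1 n : (1 : series R) n = (n == 0)%:R. Proof. by []. Qed.
Lemma coefsM f g n : (f * g) n = \sum_(i < n.+1) f i * g (n - i)%N. Proof. by []. Qed.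
Lemma coefs_sum (I : Type) (r : seq I) (P : pred I) (F : I -> series R) n :
  (\sum_(i <- r | P i) F i) n = \sum_(i <- r | P i) F i n.
Proof. exact: (big_morph (fun f : series R => f n)). Qed.

Definition qpow m : series R := Series (fun n => (n == m)%:R).
Arguments qpow m%_N.
Local Notation q := (qpow 1).
Definition sconst (a : R) : series R := Series (fun n => a *+ (n == 0)).

Lemma coefs_qpowM m f n : (qpow m * f) n = if (m <= n)%N then f (n - m)%N else 0.
Proof.
rewrite coefsM; case: leqP => le_mn.
  have lt_m : (m < n.+1)%N by [].
  rewrite (bigD1 (Ordinal lt_m)) //= eqxx mul1r big1 ?addr0 // => i.
  by rewrite -val_eqE /= => /negPf->; rewrite mul0r.
rewrite big1 // => i _ /=; have /negPf-> : (i : nat) != m by have := ltn_ord i; lia.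
by rewrite mul0r.
Qed.

Lemma qpowD m n : qpow (m + n) = qpow m * qpow n.
Proof.
apply/seriesP => i; rewrite coefs_qpowM /=.
case: leqP => le_mi; first by congr (nat_of_bool _)%:R; lia.
by have /negPf-> : i != (m + n)%N by lia.
Qed.

Lemma qpow0 : qpow 0 = 1. Proof. by apply/seriesP. Qed.

Lemma qpowE m : qpow m = q ^+ m.
Proof. by elim: m => [|m IHm]; rewrite ?qpow0 // exprS -IHm -qpowD. Qed.

Lemma coefs_constM a f n : (sconst a * f) n = a * f n.
Proof.
rewrite coefsM big_ord_recl /= subn0 big1 ?addr0 // => i _.
by rewrite mul0r.
Qed.

Lemma sconst_nat m : sconst m%:R = m%:R.
Proof.
apply/seriesP => n; elim: m => [|m IHm] /=; first by rewrite mul0rn.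
by rewrite -!natr1 coefsD -IHm /= mulrnDl.
Qed.

Lemma sconst1 : sconst 1 = 1. Proof. exact: (sconst_nat 1). Qed.

(** Congruence modulo q^(N+1). Through it infinite products and theta series are replaced with
    finite ones, and [eqm_eq] returns to equality. *)
Definition eqm N f g := forall n, (n <= N)%N -> f n = g n.

Lemma eqm_refl N f : eqm N f f. Proof. by []. Qed.
Lemma eqm_sym N f g : eqm N f g -> eqm N g f.
Proof. by move=> fg n /fg. Qed.
Lemma eqm_trans N f g h : eqm N f g -> eqm N g h -> eqm N f h.
Proof. by move=> fg gh n le_nN; rewrite fg ?gh. Qed.
Lemma eqmM N f f' g g' : eqm N f f' -> eqm N g g' -> eqm N (f * g) (f' * g').
Proof.
move=> ff gg n le_nN; rewrite !coefsM; apply: eq_bigr => i _.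
by rewrite ff ?gg //; have := ltn_ord i; lia.
Qed.
Lemma eqmX N f f' k : eqm N f f' -> eqm N (f ^+ k) (f' ^+ k).
Proof. by move=> ff; elim: k => // k IHk; rewrite !exprS; apply: eqmM. Qed.
Lemma eqm_eq f g : (forall N, eqm N f g) -> f = g.
Proof. by move=> fg; apply/seriesP => n; apply: (fg n). Qed.

Lemma eqm_qpow N m f : (N < m)%N -> eqm N (qpow m * f) 0.
Proof. by move=> lt_Nm n le_nN; rewrite coefs_qpowM ifN //; lia. Qed.

Lemma coefs_sum_qpow (I : Type) (r : seq I) (e : I -> nat) (c : I -> R) n :
  (\sum_(i <- r) sconst (c i) * qpow (e i)) n = \sum_(i <- r | e i == n) c i.
Proof.
rewrite coefs_sum [RHS]big_mkcond; apply: eq_bigr => i _.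
by rewrite coefs_constM /= eq_sym; case: eqP; rewrite ?mulr1 ?mulr0.
Qed.

Lemma eqm_trunc N f : eqm N f (\sum_(i < N.+1) sconst (f i) * qpow i).
Proof.
move=> n le_nN; rewrite (coefs_sum_qpow _ (@nat_of_ord N.+1) (fun i => f i)).
by rewrite (big_pred1 (Ordinal (le_nN : n < N.+1)%N)).
Qed.

(** * Substitution of q^k for q *)

Definition subst k f : series R :=
  Series (fun n => if (k %| n)%N then f (n %/ k)%N else 0).

Arguments subst k%_N f.

Lemma coefs_subst k f n :
  subst k f n = if (k %| n)%N then f (n %/ k)%N else 0.
Proof. by []. Qed.

Section Subst.
Variable k : nat.
Hypothesis k_gt0 : (0 < k)%N.

Lemma subst1 : subst k 1 = 1.
Proof.
apply/seriesP => n; rewrite /= ?coefs1.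
case: ifP => [/dvdnP[m ->]|]; first by rewrite mulnK // muln_eq0 (gtn_eqF k_gt0) orbF.
by case: n => //; rewrite dvdn0.
Qed.

Lemma substD f g : subst k (f + g) = subst k f + subst k g.
Proof. by apply/seriesP => n /=; rewrite ?coefsD /=; case: ifP; rewrite ?addr0. Qed.

Lemma subst_eqm N f g : eqm N f g -> eqm N (subst k f) (subst k g).
Proof.
by move=> fg n le_nN /=; case: ifP => // _; apply: fg; apply: leq_trans (leq_div _ _) _.
Qed.

Lemma subst_qpow m : subst k (qpow m) = qpow (k * m).
Proof.
apply/seriesP => n /=; case: ifP => [/dvdnP[j ->]|/negP n_k].
  by rewrite mulnK // mulnC eqn_pmul2l.
by case: eqP => // n_eq; case: n_k; rewrite n_eq dvdn_mulr.
Qed.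

Lemma subst_const a : subst k (sconst a) = sconst a.
Proof.
apply/seriesP => n /=; case: ifP => [/dvdnP[m ->]|].
  by rewrite mulnK // muln_eq0 (gtn_eqF k_gt0) orbF.
by case: n => //; rewrite dvdn0.
Qed.

Lemma subst_constqM a m f :
  subst k (sconst a * qpow m * f) = sconst a * qpow (k * m) * subst k f.
Proof.
apply/seriesP => n; rewrite -!mulrA coefs_constM coefs_qpowM !coefs_subst.
rewrite coefs_constM coefs_qpowM.
case: (boolP (k %| n)%N) => [/dvdnP[j ->]|n_k].
  rewrite mulnK // (mulnC j) leq_pmul2l //; case: leqP => // _.
  by rewrite -mulnBr dvdn_mulr // mulKn.
case: leqP => [le_n|]; last by rewrite mulr0.
by rewrite dvdn_subl ?dvdn_mulr // (negPf n_k) mulr0.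
Qed.

Lemma subst_sum (I : Type) (r : seq I) (F : I -> series R) :
  subst k (\sum_(i <- r) F i) = \sum_(i <- r) subst k (F i).
Proof.
apply: (big_morph _ substD).
by apply/seriesP => n /=; case: ifP.
Qed.

Lemma substM f g : subst k (f * g) = subst k f * subst k g.
Proof.
apply: eqm_eq => N.
(* Modulo q^(N+1) a polynomial may stand for f; by additivity only monomials remain, which
   [subst_constqM] treats. *)
pose f' := \sum_(i < N.+1) sconst (f i) * qpow i.
have ff : eqm N f f' by apply: eqm_trunc.
apply: eqm_trans (subst_eqm (eqmM ff (@eqm_refl N g))) _.
apply: eqm_sym; apply: eqm_trans (eqmM (subst_eqm ff) (@eqm_refl N _)) _.
rewrite mulr_suml !subst_sum mulr_suml => n _.
congr (scoef _ n); apply: eq_bigr => i _.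
by rewrite subst_constqM -(mulr1 (sconst _ * _)) subst_constqM subst1 mulr1.
Qed.

Lemma substX f m : subst k (f ^+ m) = subst k f ^+ m.
Proof. by elim: m => [|m IHm]; rewrite ?subst1 // !exprS substM IHm. Qed.

End Subst.

Lemma subst_comp k l f : (0 < k)%N -> (0 < l)%N -> subst k (subst l f) = subst (k * l) f.
Proof.
move=> k_gt0 l_gt0; apply/seriesP => n /=.
case: (boolP (k %| n)%N) => [/dvdnP[m ->]|n_k]; last first.
  by rewrite ifN //; apply: contra n_k; apply: dvdn_trans; rewrite dvdn_mulr.
by rewrite mulnK // (mulnC k) dvdn_pmul2r // divnMr.
Qed.

(** * Substitution of -q for q *)

Definition negq f : series R := Series (fun n => (-1) ^+ n * f n).

Lemma negqM f g : negq (f * g) = negq f * negq g.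
Proof.
apply/seriesP => n; rewrite /= ?coefsM mulr_sumr; apply: eq_bigr => i _ /=.
have -> : (-1) ^+ n = (-1) ^+ i * (-1) ^+ (n - i) :> R.
  by rewrite -exprD subnKC // -ltnS.
by rewrite mulrACA.
Qed.
Lemma negq1 : negq 1 = 1.
Proof.
apply/seriesP => n; rewrite /= ?coefs1.
by case: n => [|n]; rewrite ?expr0 ?mul1r ?mulr0.
Qed.
Lemma negqD f g : negq (f + g) = negq f + negq g.
Proof. by apply/seriesP => n; rewrite /= ?coefsD mulrDr. Qed.
Lemma negqN f : negq (- f) = - negq f.
Proof. by apply/seriesP => n; rewrite /= ?coefsN mulrN. Qed.
Lemma negq_qpow m : negq (qpow m) = (-1) ^+ m * qpow m.
Proof.
have -> : (-1) ^+ m = sconst ((-1) ^+ m) :> series R.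
  rewrite -signr_odd -[in RHS]signr_odd; case: odd; rewrite ?sconst1 //.
  apply/seriesP => n; rewrite /= expr1 ?coefsN ?coefs1; by case: eqP; rewrite ?oppr0.
apply/seriesP => n; rewrite coefs_constM /=; case: eqP => [->//|_].
by rewrite !mulr0.
Qed.
Lemma negq_eqm N f g : eqm N f g -> eqm N (negq f) (negq g).
Proof. by move=> fg n le_nN /=; rewrite fg. Qed.

End SeriesRing.
Arguments qpow R m%_N : clear implicits.
Arguments subst {R} k%_N f.

(** * Products over overpartition factors *)

Section FiniteGauss.
Variables (R : comNzRingType) (q : R).

Let D n := \prod_(1 <= i < n) (1 + q ^+ i).
Let E m n := \prod_(m <= i < n) (1 - q ^+ i).
Let T n s := (-1) ^+ s * q ^+ (s * n.+1) * D s * E s.+1 n.+1.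

(* Shanks' finite form of Gauss's identity: the sum on the right is divisible by q^(n+1). *)
Lemma finite_gauss n :
  D n.+1 * (1 + 2 * \sum_(1 <= s < n.+1) (-1) ^+ s * q ^+ (s ^ 2))
    = E 1 n.+1 + 2 * \sum_(1 <= s < n.+1) T n s.
Proof.
elim: n => [|n IHn]; first by rewrite /D /E !big_geq // !mulr0 addr0 mulr1.
(* From n to n+1 the term [T n s] is multiplied by 1 + q^(n+1) up to a difference of consecutive
   values of [V], so the corrections telescope and only [V 1] and [V n.+1] survive. *)
pose V s := (-1) ^+ s * q ^+ (s * n.+1) * D s * E s n.+1.
have TE s : (1 <= s < n.+1)%N -> T n.+1 s = (1 + q ^+ n.+1) * T n s + (V s.+1 - V s).
  move=> /andP[s_gt0 lt_sn]; rewrite /T /V.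
  have -> : D s.+1 = D s * (1 + q ^+ s) by rewrite /D big_nat_recr.
  have -> : E s n.+1 = (1 - q ^+ s) * E s.+1 n.+1 by rewrite /E big_ltn.
  have -> : E s.+1 n.+2 = E s.+1 n.+1 * (1 - q ^+ n.+1) by rewrite /E big_nat_recr.
  have -> : (s * n.+2 = s * n.+1 + s)%N by lia.
  have -> : (s.+1 * n.+1 = s * n.+1 + n.+1)%N by lia.
  rewrite !exprD (exprS (-1) s).
  move: (q ^+ _) (q ^+ s) (q ^+ n.+1) (D s) (E _ _) ((-1) ^+ s) => a b c d e f.
  ring.
have D2 : D n.+2 = D n.+1 * (1 + q ^+ n.+1) by rewrite /D big_nat_recr.
have E2 : E 1 n.+2 = E 1 n.+1 * (1 - q ^+ n.+1) by rewrite /E big_nat_recr.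
rewrite big_nat_recr //= [in RHS]big_nat_recr //= (eq_big_nat _ _ TE).
rewrite big_split /= -mulr_sumr telescope_sumr // E2.
have -> : V 1 = - q ^+ n.+1 * E 1 n.+1.
  by rewrite /V /D big_geq // mul1n expr1; ring.
have -> : V n.+1 = (-1) ^+ n.+1 * q ^+ (n.+1 ^ 2) * D n.+1.
  by rewrite /V /E big_geq // mulr1 -mulnn.
have -> : T n.+1 n.+1 = (-1) ^+ n.+1 * q ^+ (n.+1 ^ 2) * q ^+ n.+1 * D n.+1.
  rewrite /T /E big_geq // mulr1; have -> : (n.+1 * n.+2 = n.+1 ^ 2 + n.+1)%N by lia.
  by rewrite exprD; ring.
set S := \sum_(1 <= s < n.+1) _ in IHn *.
set t := _ * q ^+ (_ ^ 2).
have -> : D n.+2 * (1 + 2 * (S + t))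
    = (1 + q ^+ n.+1) * (D n.+1 * (1 + 2 * S)) + 2 * t * (1 + q ^+ n.+1) * D n.+1.
  by rewrite D2; ring.
rewrite IHn; move: t (\sum_(_ <= _ < _) _) (q ^+ n.+1) (D n.+1) (E 1 n.+1).
by move=> a b c d e; ring.
Qed.

End FiniteGauss.

(** * Infinite products and Gauss's identity *)

Section EulerProducts.
Variable R : comNzRingType.
Implicit Types (f g : series R) (e : nat -> nat).
Local Notation q := (qpow R).

Definition geom i : series R := Series (fun n => (i %| n)%:R).

Arguments geom i%_N.

Lemma geomK i : (0 < i)%N -> (1 - q i) * geom i = 1.
Proof.
move=> i_gt0; apply/seriesP => n; rewrite mulrBl mul1r coefsB coefs_qpowM coefs1 /=.
case: leqP => [le_in|lt_ni].
  by rewrite dvdn_subl // subrr; case: n le_in => //; lia.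
by case: n lt_ni => [|n] lt_ni; rewrite ?dvdn0 ?subr0 // gtnNdvd // subr0.
Qed.

Lemma geom_eqm1 i N : (N < i)%N -> eqm N (geom i) 1.
Proof.
move=> lt_Ni [|n] le_nN; rewrite coefs1 /= ?dvdn0 // gtnNdvd //.
exact: leq_ltn_trans lt_Ni.
Qed.

(** For i > 0 this is (1 + q^i) / (1 - q^i), which counts the copies of a part i, the first of which
    may be overlined. *)
Definition opfactor i := (1 + q i) * geom i.

Arguments opfactor i%_N.

Lemma opfactorE i : (0 < i)%N -> (1 - q i) * opfactor i = 1 + q i.
Proof. by move=> i_gt0; rewrite mulrCA geomK // mulr1. Qed.

Lemma opfactor_eqm1 i N : (N < i)%N -> eqm N (opfactor i) 1.
Proof.
move=> lt_Ni; rewrite /opfactor -[X in eqm _ _ X]mulr1; apply: eqmM; last exact: geom_eqm1.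
move=> n le_nN; rewrite coefsD /=.
by have /negPf-> : n != i; [lia | rewrite addr0].
Qed.

(** The infinite product of the factors to the powers [e i]. Coefficient n can be read off the first
    n factors because the later ones are 1 modulo q^(n+1). A 0/1-valued [e] selects the permitted
    parts. *)
Definition opprod e : series R :=
  Series (fun n => (\prod_(1 <= i < n.+1) opfactor i ^+ e i) n).

Lemma eqm_prod1 N m n (F : nat -> series R) :
  (forall i, (m <= i < n)%N -> eqm N (F i) 1) -> eqm N (\prod_(m <= i < n) F i) 1.
Proof.
move=> F1; rewrite big_nat; elim/big_rec: _ => [//|i f le_i f1].
by rewrite -[X in eqm _ _ X]mulr1; apply: eqmM (F1 _ le_i) f1.
Qed.

Lemma opprod_eqm e N : eqm N (opprod e) (\prod_(1 <= i < N.+1) opfactor i ^+ e i).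
Proof.
move=> n le_nN; rewrite (@big_cat_nat _ _ _ n.+1) //=.
rewrite -[X in scoef X n = _]mulr1; apply: (@eqmM _ n) => //; apply: eqm_sym.
apply: eqm_prod1 => i /andP[lt_ni _]; rewrite -[X in eqm _ _ X](expr1n _ (e i)).
by apply/eqmX/opfactor_eqm1.
Qed.

Arguments opprod_eqm : clear implicits.

Lemma opprod_unique f e :
  (forall N, eqm N f (\prod_(1 <= i < N.+1) opfactor i ^+ e i)) -> f = opprod e.
Proof. by move=> fE; apply/seriesP => n; apply: fE. Qed.

Lemma opprodD e e' : opprod e * opprod e' = opprod (fun i => e i + e' i)%N.
Proof.
apply: opprod_unique => N; apply: eqm_trans (eqmM (opprod_eqm _ _) (opprod_eqm _ _)) _.
rewrite -big_split => n _; congr (scoef _ n); apply: eq_bigr => i _.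
by rewrite exprD.
Qed.

Lemma eq_opprod e e' : (forall i, (0 < i)%N -> e i = e' i) -> opprod e = opprod e'.
Proof.
move=> ee; apply/seriesP => n /=; congr (scoef _ n).
by apply: eq_big_nat => i /andP[i_gt0 _]; rewrite ee.
Qed.

Lemma subst_opfactor k i : (0 < k)%N -> (0 < i)%N ->
  subst k (opfactor i) = opfactor (k * i).
Proof.
move=> k_gt0 i_gt0; rewrite substM // substD // subst1 // subst_qpow //; congr (_ * _).
apply/seriesP => n /=; case: (boolP (k %| n)%N) => [/dvdnP[m ->]|n_k].
  by rewrite mulnK // (mulnC m) dvdn_pmul2l.
by rewrite (_ : (k * i %| n)%N = false) //; apply: contraNF n_k; apply/dvdn_trans/dvdn_mulr.
Qed.

Lemma subst_opprod k : (0 < k)%N ->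
  subst k (opprod (fun=> 1%N)) = opprod (fun i => (k %| i)%N).
Proof.
move=> k_gt0; apply: opprod_unique => N.
apply: eqm_trans (subst_eqm k (opprod_eqm _ _)) _.
(* Only the multiples of k up to N contribute a nontrivial factor. *)
have -> : \prod_(1 <= i < N.+1) opfactor i ^+ (k %| i)%N
    = \prod_(1 <= i < (N %/ k).+1) opfactor (k * i).
  elim: N => [|N IHN]; first by rewrite div0n !big_geq.
  rewrite big_nat_recr //= IHN divnS //.
  case: (boolP (k %| N.+1)%N) => /= [k_N|_]; last by rewrite add0n mulr1.
  rewrite add1n [in RHS]big_nat_recr //= expr1; congr (_ * opfactor _).
  have := divnS N k_gt0; rewrite k_N add1n => <-.
  by rewrite mulnC divnK.
have -> : subst k (\prod_(1 <= i < N.+1) opfactor i ^+ 1)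
    = \prod_(1 <= i < N.+1) opfactor (k * i).
  rewrite (big_morph _ (substM k_gt0) (subst1 R k_gt0)).
  by apply: eq_big_nat => i /andP[i_gt0 _]; rewrite expr1 subst_opfactor.
(* The remaining factors have k * i > N, so they are 1 modulo q^(N+1). *)
rewrite (@big_cat_nat _ _ _ (N %/ k).+1) //=; last by rewrite ltnS leq_div.
rewrite -[X in eqm _ _ X]mulr1; apply: eqmM => //; apply: eqm_prod1 => i /andP[lt_i _].
by apply: opfactor_eqm1; rewrite mulnC -ltn_divLR.
Qed.

(** Changing the sign of q inverts (1 + q^i) / (1 - q^i) for odd i and fixes it for even i. *)
Lemma negq_opfactorM i : (0 < i)%N ->
  negq (opfactor i) * opfactor i = opfactor i ^+ (~~ odd i * 2).
Proof.
move=> i_gt0; case: (boolP (odd i)) => [odd_i|/negPf even_i] /=; last first.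
  rewrite /opfactor negqM negqD negq1 negq_qpow -signr_odd even_i mul1r mul1n expr2.
  congr (_ * _ * _); apply/seriesP => n /=.
  case: (boolP (i %| n)%N) => [/dvdnP[m ->]|_]; rewrite ?mulr0 //.
  by rewrite -signr_odd oddM even_i andbF mulr1.
have := congr1 (@negq R) (opfactorE i_gt0).
rewrite negqM !negqD negqN negq1 negq_qpow -signr_odd odd_i expr1 mulN1r opprK => negE.
have E := opfactorE i_gt0.
(* Instead of dividing by 1 + q^i and 1 - q^i separately, one inverts their product 1 - q^(2i). *)
have geomKq : (1 - q (i + i)) * geom (i + i) = 1 by rewrite geomK ?addn_gt0 ?i_gt0.
rewrite mul0n expr0 -[LHS]mul1r -[X in X * _]geomKq qpowD.
rewrite (_ : _ * _ =
  ((1 + q i) * negq (opfactor i)) * ((1 - q i) * opfactor i) * geom (i + i)).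
  by rewrite negE E -[RHS]geomKq qpowD; ring.
by ring.
Qed.

Lemma negq_opprodM :
  negq (opprod (fun=> 1%N)) * opprod (fun=> 1%N) = opprod (fun i => ~~ odd i * 2)%N.
Proof.
apply: opprod_unique => N.
apply: eqm_trans (eqmM (negq_eqm (opprod_eqm _ _)) (opprod_eqm _ _)) _.
rewrite (big_morph _ (@negqM R) (negq1 R)) -big_split => n _; congr (scoef _ n).
by apply: eq_big_nat => i /andP[i_gt0 _]; rewrite /= !expr1 negq_opfactorM.
Qed.

(** The limit of [finite_gauss]: the product of the 1 + q^i times the series is the product of the 1
    - q^i, which the geometric series invert. *)
Lemma gauss_opprod f :
  (forall N, eqm N f (1 + 2 * \sum_(1 <= s < N.+1) (-1) ^+ s * q (s ^ 2))) ->
  f * opprod (fun=> 1%N) = 1.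
Proof.
move=> fE; apply: eqm_eq => N.
apply: eqm_trans (eqmM (fE N) (opprod_eqm _ _)) _.
set S := 1 + _.
have gaussE : eqm N ((\prod_(1 <= i < N.+1) (1 + q i)) * S) (\prod_(1 <= i < N.+1) (1 - q i)).
  rewrite /S (eq_bigr (fun i => 1 + q 1 ^+ i)) => [|i _]; last by rewrite qpowE.
  rewrite [X in eqm _ _ X](eq_bigr (fun i => 1 - q 1 ^+ i)) => [|i _]; last by rewrite qpowE.
  rewrite [X in 2 * X](eq_bigr (fun s => (-1) ^+ s * q 1 ^+ (s ^ 2))) => [|i _]; last first.
    by rewrite qpowE.
  rewrite finite_gauss => n le_nN; rewrite coefsD.
  (* The remainder of [finite_gauss] vanishes up to degree N, since its term of index s >= 1 carries
     q^(s(N+1)). *)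
  rewrite -[RHS]addr0; congr (_ + _); rewrite mulr_sumr coefs_sum big_nat big1 // => s.
  move=> /andP[s_gt0 _]; rewrite -(qpowE _ (s * _)).
  move: (\prod_(1 <= i < s) _) (\prod_(s.+1 <= i < _) _) => d e.
  rewrite (_ : 2 * _ = q (s * N.+1) * (2 * (-1) ^+ s * d * e)); last by ring.
  by rewrite (@eqm_qpow _ N) // (leq_trans _ (leq_mul s_gt0 (leqnn _))) ?mul1n.
have EK : (\prod_(1 <= i < N.+1) (1 - q i)) * (\prod_(1 <= i < N.+1) geom i) = 1.
  by rewrite -big_split big_nat big1 // => i /andP[i_gt0 _]; rewrite /= geomK.
rewrite mulrC (eq_bigr (fun i => (1 + q i) * geom i)) => [|i _]; last by rewrite expr1.
by rewrite big_split /= mulrAC -[X in eqm _ _ X]EK; apply: eqmM.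
Qed.

End EulerProducts.
Arguments opprod R e : clear implicits.
Arguments opfactor R i%_N : clear implicits.

(** * Theta series *)

Lemma eq_big_support (V : zmodType) (I : eqType) (s t : seq I) (P : pred I) (F : I -> V) :
  uniq s -> uniq t -> (forall i, P i -> (i \in s) = (i \in t)) ->
  \sum_(i <- s | P i) F i = \sum_(i <- t | P i) F i.
Proof.
move=> s_uniq t_uniq st; rewrite -[LHS]big_filter -[RHS]big_filter.
apply/perm_big/uniq_perm; rewrite ?filter_uniq // => i.
by rewrite !mem_filter; case Pi : (P i) => //=; apply: st.
Qed.

Fixpoint zball N : seq int :=
  if N is N'.+1 then Posz N :: - Posz N :: zball N' else [:: 0].

Lemma mem_zball N k : (k \in zball N) = (`|k| <= N)%N.
Proof.
elim: N => [|N IHN] /=; first by rewrite inE; lia.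
by rewrite !inE IHN; lia.
Qed.

Lemma zball_uniq N : uniq (zball N).
Proof. by elim: N => //= N ->; rewrite !inE !mem_zball; lia. Qed.

Lemma big_zballS (V : zmodType) N (F : int -> V) :
  \sum_(k <- zball N.+1) F k = F N.+1 + (F (- N.+1%:Z) + \sum_(k <- zball N) F k).
Proof. by rewrite /= !big_cons. Qed.

Arguments zball : simpl never.

Section Theta.
Variable R : comNzRingType.
Implicit Types (e : int -> nat) (c : int -> R).
Local Notation q := (qpow R).

Definition theta e c : series R :=
  Series (fun n => \sum_(k <- zball n.+1 | e k == n) c k).

(** This bound puts every k with [e k = n] inside the ball over which [theta] sums. The successor is
    there for k(k+1), which is 0 at k = -1. *)
Definition proper_exponent e := forall k, (`|k| <= (e k).+1)%N.

Lemma coefs_theta e c n N : proper_exponent e ->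
  (forall k, e k = n -> (`|k| <= N)%N) ->
  theta e c n = \sum_(k <- zball N | e k == n) c k.
Proof.
move=> e_proper le_N; apply: eq_big_support; rewrite ?zball_uniq // => k /eqP ek.
by rewrite !mem_zball le_N //; have := e_proper k; rewrite ek => ->.
Qed.

Lemma theta_eqm e c N M : proper_exponent e ->
  (forall k, (e k <= N)%N -> (`|k| <= M)%N) ->
  eqm N (theta e c) (\sum_(k <- zball M) sconst (c k) * q (e k)).
Proof.
move=> e_proper le_M n le_nN; rewrite coefs_sum_qpow; apply: coefs_theta => // k ek.
by apply: le_M; rewrite ek.
Qed.

Lemma eq_theta e e' c c' : e =1 e' -> c =1 c' -> theta e c = theta e' c'.
Proof.
by move=> ee cc; apply/seriesP => n; apply: eq_big => k; rewrite ?ee ?cc.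
Qed.

Lemma thetaN e c : theta e (fun k => - c k) = - theta e c.
Proof. by apply/seriesP => n; rewrite coefsN /= sumrN. Qed.

Lemma theta_shift e c s : proper_exponent e ->
  theta (fun k => e k + s)%N c = q s * theta e c.
Proof.
move=> e_proper; apply/seriesP => n; rewrite coefs_qpowM.
rewrite (@coefs_theta _ _ _ n.+1); first last.
- by move=> k <-; have := e_proper k; lia.
- by move=> k; have := e_proper k; lia.
case: leqP => le_sn; last by rewrite big1 // => k /eqP; lia.
rewrite (@coefs_theta _ _ _ n.+1) //; last by move=> k ek; have := e_proper k; lia.
by apply: eq_bigl => k; lia.
Qed.

Lemma theta_subst e c d : (0 < d)%N -> proper_exponent e ->
  theta (fun k => d * e k)%N c = subst d (theta e c).
Proof.
move=> d_gt0 e_proper.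
have de_proper : proper_exponent (fun k => d * e k)%N.
  by move=> k; have := e_proper k; nia.
apply/seriesP => n; rewrite coefs_subst (@coefs_theta _ _ n n.+1) //; last first.
  by move=> k <-; apply: de_proper.
case: ifP => [/dvdnP[m ->]|n_d]; last first.
  by rewrite big1 // => k /eqP n_eq; rewrite -n_eq dvdn_mulr in n_d.
rewrite mulnK // (@coefs_theta _ _ m (m * d).+1) //; last first.
  by move=> k ek; have := e_proper k; nia.
by apply: eq_bigl => k; rewrite mulnC eqn_pmul2r.
Qed.

Lemma theta_split m e c : (0 < m)%N -> proper_exponent e ->
  (forall r : nat, (r < m)%N -> proper_exponent (fun k => e (m%:Z * k + r%:Z))) ->
  theta e c =
  \sum_(0 <= r < m) theta (fun k => e (m%:Z * k + r%:Z)) (fun k => c (m%:Z * k + r%:Z)).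
Proof.
move=> m_gt0 e_proper er_proper; apply/seriesP => n; rewrite coefs_sum /=.
(* This range is arranged by residues modulo m; by Euclidean division it agrees with the ball at
   every k with [e k = n]. *)
pose t := [seq m%:Z * k + r%:Z | r <- index_iota 0 m, k <- zball n.+1].
transitivity (\sum_(k <- t | e k == n) c k); last first.
  rewrite big_mkcond big_allpairs_dep; apply: eq_bigr => r _.
  by rewrite [RHS]big_mkcond.
apply: eq_big_support; rewrite ?zball_uniq //.
  apply: allpairs_uniq; rewrite ?iota_uniq ?zball_uniq //.
  move=> [r k] [r' k'] /allpairsP[[a b] [a_m _ [-> ->]]].
  move=> /allpairsP[[a' b'] [a'_m _ [-> ->]]] /= eq_k.
  rewrite !mem_index_iota /= in a_m a'_m.
  have [lt_b lt_b'] : ~ (b < b' :> int)%R /\ ~ (b' < b :> int)%R by split; nia.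
  have eq_b : b = b' :> int by lia.
  by rewrite eq_b in eq_k *; congr pair; lia.
move=> k /eqP ek; rewrite mem_zball -[in LHS]ek e_proper; apply/esym/allpairsP.
have m_neq0 : m%:Z != 0 by lia.
have r_ge0 := modz_ge0 k m_neq0.
have r_lt := ltz_pmod k (d := m) m_gt0.
have k_eq : m%:Z * (k %/ m)%Z + `|(k %% m)%Z|%N = k.
  by rewrite gez0_abs // mulrC -divz_eq.
exists (`|(k %% m)%Z|%N, (k %/ m)%Z); split; rewrite /= ?k_eq //.
  by rewrite mem_index_iota; lia.
rewrite mem_zball; have := @er_proper `|(k %% m)%Z|%N _ (k %/ m)%Z.
by rewrite k_eq ek; apply; lia.
Qed.

(* In Ramanujan's notation these are phi(-q) and 2 psi(q^2). *)
Definition phi : series R := theta (fun k => absz k ^ 2)%N (fun k => (-1) ^+ absz k).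
Definition psi2 : series R := theta (fun k => absz (k * (k + 1))) (fun=> 1).

Lemma sqr_proper : proper_exponent (fun k => absz k ^ 2)%N.
Proof. by move=> k; nia. Qed.
Lemma pronic_proper : proper_exponent (fun k => absz (k * (k + 1))).
Proof. by move=> k; nia. Qed.

Lemma negq_phi : negq phi = theta (fun k => absz k ^ 2)%N (fun=> 1).
Proof.
apply/seriesP => n /=; rewrite mulr_sumr; apply: eq_bigr => k /eqP <-.
by rewrite -exprD -signr_odd oddD oddX /= addbb.
Qed.

Lemma phi_opprod : phi * opprod R (fun=> 1%N) = 1.
Proof.
apply: gauss_opprod => N.
apply: eqm_trans (theta_eqm _ (M := N) sqr_proper _) _; first by move=> k; nia.
have -> : \sum_(k <- zball N) sconst ((-1) ^+ absz k) * q (absz k ^ 2)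
  = 1 + 2 * \sum_(1 <= s < N.+1) (-1) ^+ s * q (s ^ 2); last by [].
have signE s : sconst ((-1) ^+ s) = (-1) ^+ s :> series R.
  rewrite -signr_odd -[in RHS]signr_odd; case: odd; rewrite ?sconst1 // expr1.
  by apply/seriesP => n; rewrite /= ?coefsN ?coefs1; case: eqP; rewrite ?oppr0.
elim: N => [|N IHN].
  by rewrite big_geq // mulr0 addr0 big_seq1 expr0 sconst1 mul1r qpow0.
rewrite big_zballS IHN !signE abszN absz_nat [in RHS]big_nat_recr //=.
by ring.
Qed.

(** Even indices give the exponents 4k^2 with sign +, odd ones (2k+1)^2 = 4k(k+1) + 1 with sign
    -. *)
Lemma phi_split2 : phi = subst 4 (negq phi) - q 1 * subst 4 psi2.
Proof.
rewrite [LHS](@theta_split 2) //; first last.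
- by case=> [|[|]] // _ k; nia.
- exact: sqr_proper.
rewrite big_nat_recr //= big_nat1; congr (_ + _).
  rewrite negq_phi -theta_subst //; last exact: sqr_proper.
  apply: eq_theta => k; first by nia.
  by rewrite -signr_odd (_ : odd _ = false) //; lia.
rewrite -theta_subst; last exact: pronic_proper; last by [].
rewrite -theta_shift; last by move=> k; nia.
rewrite -thetaN; apply: eq_theta => k; first by nia.
by rewrite -signr_odd (_ : odd _ = true) //; lia.
Qed.

(** Multiples of 3 give the exponents 9k^2. Every other square is 1 mod 3, and [e1], [e2] are
    ((3k+r)^2 - 1)/3 for r = 1, 2. *)
Lemma phi_split3 : exists d : series R, phi = subst 9 phi + q 1 * subst 3 d.
Proof.
pose e1 (k : int) := absz (3 * k ^+ 2 + 2 * k); pose e2 (k : int) := absz (3 * k ^+ 2 + 4 * k + 1).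
have e1_proper : proper_exponent e1 by move=> k; rewrite /e1; nia.
have e2_proper : proper_exponent e2 by move=> k; rewrite /e2; nia.
exists (theta e1 (fun k => (-1) ^+ absz (3 * k + 1))
  + theta e2 (fun k => (-1) ^+ absz (3 * k + 2))).
rewrite [LHS](@theta_split 3) //; first last.
- by case=> [|[|[|]]] // _ k; nia.
- exact: sqr_proper.
rewrite 3?big_ltn // big_geq // addr0; congr (_ + _).
  rewrite -theta_subst //; last exact: sqr_proper.
  apply: eq_theta => k; first by nia.
  by rewrite -signr_odd -[RHS]signr_odd; congr ((-1) ^+ (nat_of_bool _)); lia.
rewrite substD // mulrDr -!theta_subst // -!theta_shift; first last.
- by move=> k; have := e1_proper k; nia.
- by move=> k; have := e2_proper k; nia.
by congr (_ + _); apply: eq_theta => k //; rewrite /e1 /e2; nia.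
Qed.

(** The residue 1 gives (3k+1)(3k+2) = 9k(k+1) + 2. The residues 0 and 2 give multiples of 3, whose
    thirds are [e1] and [e2]. *)
Lemma psi2_split3 : exists a : series R, psi2 = subst 3 a + q 2 * subst 9 psi2.
Proof.
pose e1 (k : int) := absz (3 * k ^+ 2 + k); pose e2 (k : int) := absz (3 * k ^+ 2 + 5 * k + 2).
have e1_proper : proper_exponent e1 by move=> k; rewrite /e1; nia.
have e2_proper : proper_exponent e2 by move=> k; rewrite /e2; nia.
exists (theta e1 (fun=> 1) + theta e2 (fun=> 1)).
rewrite [LHS](@theta_split 3) //; first last.
- by case=> [|[|[|]]] // _ k; nia.
- exact: pronic_proper.
rewrite 3?big_ltn // big_geq // addr0 addrA addrAC substD // -!theta_subst //;
  last exact: pronic_proper.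
rewrite -theta_shift; last by move=> k; nia.
by congr (_ + _ + _); apply: eq_theta => k //; rewrite /e1 /e2; nia.
Qed.

End Theta.
Arguments phi R : clear implicits.
Arguments psi2 R : clear implicits.

(** * Hurwitz quaternions of given norm *)

(** Without fixed points every orbit has exactly three elements; the induction removes one orbit [o]
    at a time. *)
Lemma dvdn_size_free_order3 (T : eqType) (f : T -> T) (s : seq T) :
  uniq s -> {in s, forall x, [/\ f x \in s, f (f (f x)) = x & f x != x]} ->
  (3 %| size s)%N.
Proof.
have [n] := ubnP (size s); elim: n s => // n IHn [|x s'] //.
set s := x :: s' => size_s s_uniq fP.
have xs : x \in s by rewrite inE eqxx.
have [fx_s f3x fx_x] := fP _ xs; have [ffx_s _ ffx_fx] := fP _ fx_s.
have ffx_x : f (f x) != x.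
  by apply: contra fx_x => /eqP ffx; move: (f3x); rewrite ffx => ->.
pose o := [:: x; f x; f (f x)].
pose t := [seq y <- s | y \notin o].
have s_perm : perm_eq s (o ++ t).
  apply: uniq_perm => //.
    rewrite cat_uniq filter_uniq // andbT /= !inE negb_or eq_sym fx_x eq_sym ffx_x.
    rewrite eq_sym ffx_fx /=; apply/hasPn => y; rewrite mem_filter => /andP[yo _].
    exact: yo.
  move=> y; rewrite mem_cat mem_filter; case: (boolP (y \in o)) => //=.
  by rewrite !inE => /or3P[] /eqP->.
rewrite (perm_size s_perm) size_cat dvdn_addr //; apply: IHn.
- by move: size_s; rewrite (perm_size s_perm) size_cat /=; lia.
- by rewrite filter_uniq.
move=> y; rewrite mem_filter => /andP[yo ys]; have [fy_s f3y fy_y] := fP _ ys.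
split=> //; rewrite mem_filter fy_s andbT; apply: contra yo; rewrite !inE.
have [_ f3fx _] := fP _ fx_s.
by case/or3P => /eqP fy; move: f3y; rewrite fy ?f3x => <-; rewrite eqxx ?orbT.
Qed.

Section SumsOfFour.

Lemma mem_pairs (S T : eqType) (s : seq S) (t : seq T) x y :
  ((x, y) \in [seq (a, b) | a <- s, b <- t]) = (x \in s) && (y \in t).
Proof.
apply/allpairsP/andP => [[[a b] /= [as_ bt [-> ->]]]|[xs yt]] //.
by exists (x, y).
Qed.

Lemma pairs_uniq (S T : eqType) (s : seq S) (t : seq T) :
  uniq s -> uniq t -> uniq [seq (a, b) | a <- s, b <- t].
Proof. by move=> s_uniq t_uniq; apply: allpairs_uniq => // -[a b] [c d]. Qed.

(** The pairs of pairs mirror the computation of a fourth power as the square of a square. *)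
Definition quads N : seq ((int * int) * (int * int)) :=
  [seq (p, p') | p <- [seq (a, b) | a <- zball N, b <- zball N],
                 p' <- [seq (c, d) | c <- zball N, d <- zball N]].

Lemma mem_quads N a b c d : (((a, b), (c, d)) \in quads N) =
  [&& absz a <= N, absz b <= N, absz c <= N & absz d <= N]%N.
Proof. by rewrite !mem_pairs !mem_zball -andbA. Qed.

Lemma quads_uniq N : uniq (quads N).
Proof. by rewrite !pairs_uniq ?zball_uniq. Qed.

Definition esum4 (e : int -> nat) (v : (int * int) * (int * int)) :=
  (e v.1.1 + e v.1.2 + (e v.2.1 + e v.2.2))%N.

Variable R : comNzRingType.
Local Notation q := (qpow R).

Lemma sqr_sum_qpow (I : Type) (s : seq I) (c : I -> R) (e : I -> nat) :
  (\sum_(i <- s) sconst (c i) * q (e i)) ^+ 2 =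
  \sum_(p <- [seq (i, j) | i <- s, j <- s]) sconst (c p.1 * c p.2) * q (e p.1 + e p.2).
Proof.
rewrite expr2 big_distrlr /= big_allpairs; apply: eq_bigr => i _; apply: eq_bigr => j _ /=.
rewrite qpowD mulrACA; congr (_ * _).
apply/seriesP => n; rewrite coefs_constM /=; case: eqP => //.
by rewrite mulr0.
Qed.

Lemma coefs_theta4 (e : int -> nat) (c : int -> R) n N : proper_exponent e ->
  (forall k, (e k <= n)%N -> (absz k <= N)%N) ->
  (theta e c ^+ 4) n =
  \sum_(v <- quads N | esum4 e v == n) c v.1.1 * c v.1.2 * (c v.2.1 * c v.2.2).
Proof.
move=> e_proper le_N; rewrite (eqmX 4 (theta_eqm c e_proper le_N)) //.
rewrite (exprM _ 2 2) sqr_sum_qpow.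
rewrite (sqr_sum_qpow _ (fun p => c p.1 * c p.2) (fun p => e p.1 + e p.2)%N).
by rewrite coefs_sum_qpow.
Qed.

Lemma sumr_count (I : Type) (s : seq I) (P : pred I) (a : R) :
  \sum_(i <- s | P i) a = a *+ count P s.
Proof. by rewrite big_const_seq iter_addr_0. Qed.

End SumsOfFour.

(* The norm form of the Hurwitz quaternions in the basis ((1+i+j+k)/2, i, j, k), and left
   multiplication by the unit (-1+i+j+k)/2 of order 3. *)
Definition hurwitz_norm (v : (int * int) * (int * int)) : int :=
  let: ((a, b), (c, d)) := v in
  a ^+ 2 + b ^+ 2 + c ^+ 2 + d ^+ 2 + a * (b + c + d).

Definition hurwitz_rot (v : (int * int) * (int * int)) : (int * int) * (int * int) :=
  let: ((a, b), (c, d)) := v in ((- (2 * a + b + c + d), a + d), (a + b, a + c)).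

Lemma hurwitz_norm_rot v : hurwitz_norm (hurwitz_rot v) = hurwitz_norm v.
Proof. by case: v => [[a b] [c d]] /=; ring. Qed.

Lemma hurwitz_rot3 v : hurwitz_rot (hurwitz_rot (hurwitz_rot v)) = v.
Proof. by case: v => [[a b] [c d]] /=; congr ((_, _), (_, _)); ring. Qed.

(** Left multiplication by a unit other than 1 fixes only the zero quaternion. *)
Lemma hurwitz_rot_free v : hurwitz_rot v = v -> hurwitz_norm v = 0.
Proof.
case: v => [[a b] [c d]] /= [h1 h2 h3 h4].
have -> : a = 0 by lia.
have -> : b = 0 by lia.
have -> : c = 0 by lia.
have -> : d = 0 by lia.
by [].
Qed.

(** The first count is that of integral quaternions of norm n. The second is that of half-integral
    ones: the sum of four squares (k + 1/2)^2 is the sum of the k(k+1) plus 1, whence the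
    successor. *)
Lemma hurwitz_count n : (0 < n)%N ->
  (3 %| count (fun v => esum4 (fun k => absz k ^ 2) v == n) (quads n)
      + count (fun v => (esum4 (fun k => absz (k * (k + 1))%R) v).+1 == n) (quads n))%N.
Proof.
move=> n_gt0; set P0 := fun v => _ == n; set P1 := (fun v => _.+1 == n).
(* [g r] gives the Hurwitz coordinates of the quaternion with usual coordinates v + r/2; r = 0 is
   the integral case and r = 1 the half-integral one. *)
pose g (r : int) (v : (int * int) * (int * int)) : (int * int) * (int * int) :=
  ((2 * v.1.1 + r, v.1.2 - v.1.1), (v.2.1 - v.1.1, v.2.2 - v.1.1)).
have g_inj r : injective (g r).
  move=> [[a b] [c d]] [[a' b'] [c' d']] [/= h1 h2 h3 h4].
  by congr ((_, _), (_, _)); lia.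
pose s := map (g 0) (filter P0 (quads n)) ++ map (g 1) (filter P1 (quads n)).
have sqE k : Posz (absz k ^ 2)%N = k ^+ 2 by lia.
have proE (k : int) : Posz (absz (k * (k + 1))) = k * (k + 1) by nia.
have P0E v : P0 v = (hurwitz_norm (g 0 v) == n).
  case: v => [[a b] [c d]]; rewrite /P0 -eqz_nat /esum4 /= !PoszD !sqE.
  by congr (_ == _); ring.
have P1E v : P1 v = (hurwitz_norm (g 1 v) == n).
  case: v => [[a b] [c d]]; rewrite /P1 -eqz_nat /esum4 /= -addn1 !PoszD !proE.
  by congr (_ == _); ring.
have P0_le v : P0 v -> v \in quads n.
  case: v => [[a b] [c d]] /eqP; rewrite mem_quads /esum4 /= => <-.
  have le (k : int) : (absz k <= absz k ^ 2)%N by nia.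
  have := le a; have := le b; have := le c; have := le d.
  by move=> *; apply/and4P; split; lia.
have P1_le v : P1 v -> v \in quads n.
  case: v => [[a b] [c d]] /eqP; rewrite mem_quads /esum4 /= => <-.
  have le (k : int) : (absz k <= (absz (k * (k + 1))%R).+1)%N by nia.
  have := le a; have := le b; have := le c; have := le d.
  by move=> *; apply/and4P; split; lia.
have mem_s v : (v \in s) = (hurwitz_norm v == n).
  rewrite mem_cat; apply/orP/idP => [[]/mapP[w] | norm_v].
  - by rewrite mem_filter P0E => /andP[? _] ->.
  - by rewrite mem_filter P1E => /andP[? _] ->.
  (* The parity of the coordinate a along (1+i+j+k)/2 tells the two kinds apart. *)
  case: v norm_v => [[a b] [c d]] norm_v; pose h := (a %/ 2)%Z.
  have [a_eq|a_eq] : a = 2 * h + 0 \/ a = 2 * h + 1 by rewrite /h; lia.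
    have gE : ((a, b), (c, d)) = g 0 ((h, b + h), (c + h, d + h)).
      by rewrite /g /= -a_eq !addrK.
    by left; rewrite gE mem_map // mem_filter P0_le P0E -gE norm_v.
  have gE : ((a, b), (c, d)) = g 1 ((h, b + h), (c + h, d + h)).
    by rewrite /g /= -a_eq !addrK.
  by right; rewrite gE mem_map // mem_filter P1_le P1E -gE norm_v.
have size_s : size s = (count P0 (quads n) + count P1 (quads n))%N.
  by rewrite size_cat !size_map !size_filter.
rewrite -size_s; apply: (@dvdn_size_free_order3 _ hurwitz_rot).
  rewrite cat_uniq !map_inj_uniq // !filter_uniq ?quads_uniq // andbT /=.
  apply/hasPn => _ /mapP[[[a b] [c d]] _ ->]; apply/mapP => -[[[a' b'] [c' d']] _].
  by rewrite /g /= => -[]; lia.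
move=> v; rewrite !mem_s hurwitz_norm_rot => /eqP norm_v; split.
- by rewrite norm_v.
- exact: hurwitz_rot3.
by apply/eqP => /hurwitz_rot_free; rewrite norm_v; lia.
Qed.

(** * Congruences modulo 3 *)

Section InverseIdentities.
Variable R : comNzRingType.

(** To be used with p and r the overpartition series in q and q^8: the cubes are their versions in
    q^3 and q^24, and cancelling leaves g = r^2 / p^2. *)
Lemma quotient_cubes (x p y r g : R) : x * p = 1 -> y * r = 1 ->
  g * r * p ^+ 3 = p * r ^+ 3 -> g * y ^+ 2 = x ^+ 2.
Proof.
move=> xp yr gE.
have -> : g * y ^+ 2 = (g * r * p ^+ 3) * x ^+ 3 * y ^+ 3.
  transitivity ((x * p) ^+ 3 * (y * r) * g * y ^+ 2); last by ring.
  by rewrite xp yr expr1n !mul1r.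
rewrite gE; transitivity ((x * p) * (y * r) ^+ 3 * x ^+ 2); first by ring.
by rewrite xp yr expr1n !mul1r.
Qed.

Lemma inverse_unique (a b c : R) : a * b = 1 -> c * b = 1 -> a = c.
Proof. by move=> ab cb; rewrite -[LHS]mulr1 -cb mulrCA ab mulr1. Qed.

(** Expanding the square and dividing by a x. When a, x, w and the inverses are series in q^4, the
    three terms are separated by their exponents modulo 4. *)
Lemma square_quotient (g a x w p n q : R) : x * p = 1 -> a * n = 1 ->
  g * (a * x) = (a - q * w) ^+ 2 ->
  g = a * p - (q * (w * p)) *+ 2 + q ^+ 2 * (w ^+ 2 * p * n).
Proof.
move=> xp an gE.
transitivity (g * (a * x) * p * n).
  transitivity (g * (x * p) * (a * n)); last by ring.
  by rewrite xp an !mulr1.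
rewrite gE.
transitivity (a * p * (a * n) - (q * (w * p)) *+ 2 * (a * n) + q ^+ 2 * (w ^+ 2 * p * n)).
  by ring.
by rewrite an !mulr1.
Qed.

End InverseIdentities.

Section ModThree.
Local Notation F := 'F_3.
Local Notation q := (qpow F).
Local Notation x := (phi F).
Local Notation W := (psi2 F).
Local Notation P := (opprod F (fun=> 1%N)).
Implicit Types f g : series F.

Lemma natr3 : 3 = 0 :> series F.
Proof.
rewrite -sconst_nat; apply/seriesP => n /=.
by rewrite (_ : 3 = 0 :> F) ?mul0rn //; apply/eqP.
Qed.

Lemma pchar_series3 : 3 \in [pchar series F].
Proof. by apply/andP; split=> //; apply/eqP/natr3. Qed.

(** Cubing is additive in characteristic 3, and each coefficient, being in F_3, equals its own
    cube. *)
Lemma cube_subst f : f ^+ 3 = subst 3 f.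
Proof.
apply: eqm_eq => N.
apply: eqm_trans (eqmX 3 (@eqm_trunc _ N f)) _.
apply: eqm_sym; apply: eqm_trans (subst_eqm 3 (@eqm_trunc _ N f)) _.
move=> n _; congr (scoef _ n).
rewrite subst_sum -(pFrobenius_autE pchar_series3) rmorph_sum; apply: eq_bigr => i _ /=.
rewrite pFrobenius_autE exprMn substM // subst_qpow // subst_const //.
rewrite (qpowE _ (3 * i)%N) (qpowE _ i) -exprM mulnC.
congr (_ * _); apply/seriesP => m; rewrite exprS expr2 !coefs_constM /=.
case: eqP => _; rewrite ?mulr0 // !mulr1n.
by apply/eqP; case: (f i) => [[|[|[|]]]].
Qed.

Lemma exp9_subst f : f ^+ 9 = subst 9 f.
Proof. by rewrite (exprM _ 3 3) !cube_subst subst_comp. Qed.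

Lemma phi4_mod3 : x ^+ 4 = 1 + q 1 * W ^+ 4.
Proof.
apply/seriesP => n; rewrite coefsD coefs_qpowM coefs1.
rewrite (coefs_theta4 _ (N := n)); first last.
- by move=> k; nia.
- exact: sqr_proper.
case: n => [|n]; first by rewrite /= addr0 unlock /= !mulr1 addr0.
rewrite add0r subn1 succnK (coefs_theta4 _ (N := n.+1)); first last.
- by move=> k; nia.
- exact: pronic_proper.
(* An integer and its square have the same parity, so all representations of n+1 carry the same
   sign. *)
rewrite (eq_bigr (fun=> (-1) ^+ n.+1)) => [|[[a b] [c d]] /eqP]; last first.
  have sqE m : (-1) ^+ (m ^ 2) = (-1) ^+ m :> F by rewrite -signr_odd oddX signr_odd.
  by rewrite /esum4 /= => <-; rewrite !exprD !sqE.
rewrite [RHS](eq_bigr (fun=> 1)) => [|v _]; last by rewrite !mulr1.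
rewrite !sumr_count.
set r4 := count _ _; set o4 := count _ _.
have := hurwitz_count (ltn0Sn n); rewrite -/r4.
rewrite (_ : count _ _ = o4); last by apply: eq_count => v.
rewrite (dvdn_pcharf (pchar_Fp (isT : prime 3))) natrD => /eqP/addr0_eq o4E.
(* The two counts are opposite in F_3, which settles odd n+1. For even n+1 both are 0 in F_3,
   because the k(k+1) are even and cannot sum to the odd number n. *)
rewrite -o4E -signr_odd; case: (boolP (odd n.+1)) => [_|even_n].
  by rewrite expr1 mulNrn.
have o40 : o4 = 0%N.
  apply/eqP; rewrite -leqn0 leqNgt -has_count; apply/hasPn => -[[a b] [c d]] _.
  have pro_even (k : int) : ~~ odd (absz (k * (k + 1))).
    rewrite abszM oddM; lia.
  have := pro_even a; have := pro_even b; have := pro_even c; have := pro_even d.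
  rewrite /esum4 /=; lia.
by move: o4E; rewrite o40 mulr0n => /eqP; rewrite oppr_eq0 => /eqP ->; rewrite oppr0.
Qed.

Lemma qpow_inj m f g : q m * f = q m * g -> f = g.
Proof.
move=> fg; apply/seriesP => n.
have := congr1 (fun h : series F => h (m + n)%N) fg.
by rewrite !coefs_qpowM leq_addr addKn.
Qed.

(** For j < k the series q^j f(q^k) lives on the exponents congruent to j modulo k; this reads
    coefficients off dissections. *)
Lemma coefs_qpow_subst k j f m : (j < k)%N -> 
  (q j * subst k f) m = if (m %% k == j)%N then f (m %/ k)%N else 0.
Proof.
move=> lt_jk; have k_gt0 : (0 < k)%N by lia.
rewrite coefs_qpowM coefs_subst; move: (divn_eq m k) (ltn_pmod m k_gt0).
move: (m %/ k)%N (m %% k)%N => a b -> lt_bk.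
case: eqP => [->|neq_j].
  by rewrite leq_addl addnK dvdn_mull // mulnK.
case: leqP => // le_j; rewrite -eqn_mod_dvd // modnMDl !modn_small //.
by case: eqP.
Qed.

Lemma psi2_phi_coef n : (W * P) (9 * n + 8)%N = 0.
Proof.
have [d xE] := phi_split3 F; have [a WE] := psi2_split3 F.
rewrite -exp9_subst -cube_subst in xE; rewrite -exp9_subst -cube_subst in WE.
have xP : x * P = 1 := phi_opprod F.
have K := phi4_mod3.
have q2E : q 2 = q 1 ^+ 2 by rewrite qpowE.
rewrite q2E in WE.
(* W - q^2 W^9 = W (1 - (q W^4)^2), where q W^4 = x^4 - 1. *)
have a3E : a ^+ 3 = W * (2 * x ^+ 4 - x ^+ 8).
  have -> : a ^+ 3 = W - q 1 ^+ 2 * W ^+ 9 by rewrite {1}WE; ring.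
  have -> : x ^+ 8 = (x ^+ 4) ^+ 2 by rewrite -exprM.
  by rewrite K; ring.
(* x - x^9 = -x (x^4 - 1)(x^4 + 1), where x^4 - 1 = q W^4 allows cancelling q. *)
have d3E : d ^+ 3 = - x * W ^+ 4 * (x ^+ 4 + 1).
  apply: (@qpow_inj 1); have -> : q 1 * d ^+ 3 = x - x ^+ 9 by rewrite {1}xE; ring.
  have -> : x ^+ 9 = x * (x ^+ 4) ^+ 2 by rewrite -exprM -exprS.
  by rewrite K; ring.
(* Since 2 - x^4 = -(x^4 + 1) mod 3, the second summand is -W^9 x^6 (x^4 + 1)^3, whose x^18 term
   cancels the first. As a polynomial identity the sides differ by 3 W^9 x^10, hence the zero added
   below. *)
have E : W ^+ 9 * x ^+ 18 + a ^+ 3 * (d ^+ 3) ^+ 2 = 2 * (x ^+ 2 * W ^+ 3) ^+ 3.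
  rewrite a3E d3E -[RHS]addr0 -(mul0r (W ^+ 9 * x ^+ 10)) -natr3; ring.
(* The product of the 3-dissections, with the terms in q^2 collected last so that [E] turns them
   into a cube. *)
have Wx2E : W * x ^+ 2 = a ^+ 3 * x ^+ 18 + q 1 ^+ 4 * W ^+ 9 * d ^+ 6
    + 2 * (q 1 ^+ 3 * x ^+ 9 * W ^+ 9 * d ^+ 3) + 2 * (q 1 * x ^+ 9 * a ^+ 3 * d ^+ 3)
    + q 1 ^+ 2 * (W ^+ 9 * x ^+ 18 + a ^+ 3 * (d ^+ 3) ^+ 2).
  by rewrite {1}xE {1}WE; ring.
(* W P = P^3 (W x^2), and the cube P^3 is absorbed into each term of [Wx2E]; q^3 and q^4 become a
   cube of q and q times such a cube. *)
have [c1 [c2 [c3 [c4 wE]]]] : exists c1 c2 c3 c4, W * P =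
    c1 ^+ 3 + q 1 * c2 ^+ 3 + c3 ^+ 3 *+ 2 + (q 1 * c4 ^+ 3) *+ 2
    + (q 2 * (x * W ^+ 3) ^+ 3) *+ 2.
  exists (P * a * x ^+ 6), (q 1 * P * W ^+ 3 * d ^+ 2), (q 1 * P * x ^+ 3 * W ^+ 3 * d).
  exists (P * x ^+ 3 * a * d).
  have -> : x * W ^+ 3 = P * (x ^+ 2 * W ^+ 3).
    by rewrite expr2 !mulrA (mulrC P) xP mul1r.
  have -> : W * P = P ^+ 3 * (W * x ^+ 2).
    by rewrite -[LHS]mulr1 -(expr1n _ 2) -xP; ring.
  by rewrite Wx2E E q2E; ring.
(* As 9n+8 = 3(3n+2) + 2, only q^2 times a cube contributes here, through coefficient 3n+2 of the
   cubed series. *)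
have cubeE j f : (j < 3)%N ->
    (q j * f ^+ 3) (9 * n + 8)%N = if (2 == j)%N then f (3 * n + 2)%N else 0.
  move=> lt_j; rewrite cube_subst coefs_qpow_subst //.
  have -> : ((9 * n + 8) %/ 3 = 3 * n + 2)%N by lia.
  by have -> : ((9 * n + 8) %% 3 = 2)%N by lia.
have cube0 f : (f ^+ 3) (9 * n + 8)%N = 0 by rewrite -(mul1r (f ^+ 3)) -qpow0 cubeE.
have cube1 f : (q 1 * f ^+ 3) (9 * n + 8)%N = 0 by rewrite cubeE.
have xW30 : (x * W ^+ 3) (3 * n + 2)%N = 0.
  have -> : x * W ^+ 3 = q 0 * (x ^+ 3 * W) ^+ 3 + q 1 * (d * W) ^+ 3.
    by rewrite {1}xE qpow0; ring.
  rewrite coefsD !cube_subst !coefs_qpow_subst //.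
  have -> : ((3 * n + 2) %% 3 = 2)%N by lia.
  by rewrite addr0.
have cube2 : (q 2 * (x * W ^+ 3) ^+ 3) (9 * n + 8)%N = 0 by rewrite cubeE.
by rewrite wE !mulr2n !coefsD !cube0 !cube1 cube2 !addr0.
Qed.

Definition regular83 i : nat := ~~ (8 %| i)%N && ~~ (3 %| i)%N.

Lemma opprod_regular83_coef n : opprod F regular83 (36 * n + 33)%N = 0.
Proof.
set G := opprod _ _.
have xP : x * P = 1 := phi_opprod F.
have xPk k : (0 < k)%N -> subst k x * subst k P = 1.
  by move=> k_gt0; rewrite -substM // xP subst1.
(* Inclusion-exclusion on the exponents: the indicator of being prohibited is [8 | i] + [3 | i] -
   [24 | i]. *)
have GP : G * subst 8 P * subst 3 P = P * subst 24 P.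
  rewrite !subst_opprod // !opprodD; apply: eq_opprod => i _.
  by rewrite /regular83; have -> : (24 %| i)%N = (8 %| i)%N && (3 %| i)%N; lia.
have Gx : G * subst 8 x ^+ 2 = x ^+ 2.
  apply: (quotient_cubes xP (xPk 8 isT)).
  by rewrite !cube_subst subst_comp.
have negxP : negq x * negq P = 1 by rewrite -negqM xP negq1.
(* Both sides invert the same product, in which the odd factors cancel and the even ones are
   squared. *)
have negxE : negq x * x = subst 2 x ^+ 2.
  apply: (@inverse_unique _ _ (negq P * P)); first by rewrite mulrACA xP negxP mulr1.
  have -> : negq P * P = subst 2 P ^+ 2.
    rewrite negq_opprodM expr2 subst_opprod // opprodD; apply: eq_opprod => i _.
    by rewrite dvdn2; case: odd.
  by rewrite -exprMn xPk // expr1n.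
(* The square of [phi_split2] divided by [subst 4 (negq x * x)], which is [subst 8 x ^+ 2]. Only the
   middle term has exponents 1 mod 4. *)
have GE : G = q 0 * subst 4 (negq x * P) - (q 1 * subst 4 (W * P)) *+ 2
    + q 2 * subst 4 (W ^+ 2 * P * negq P).
  rewrite !substM // -expr2 qpow0 mul1r (qpowE _ 2).
  apply: (square_quotient (xPk 4 isT)); first by rewrite -substM // negxP subst1.
  rewrite -phi_split2 -Gx; congr (_ * _).
  by rewrite -substM // negxE substX // subst_comp.
rewrite GE mulr2n !coefsD coefsN coefsD !coefs_qpow_subst //.
have -> : ((36 * n + 33) %% 4 = 1)%N by lia.
have -> : ((36 * n + 33) %/ 4 = 9 * n + 8)%N by lia.
by rewrite psi2_phi_coef !addr0 oppr0 addr0.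
Qed.

End ModThree.

(** * Generating function of overpartitions *)

(* For nonincreasing parts, overlining only first occurrences means that no overlined part
   is preceded by an equal one, which turns validity into sortedness for one relation. *)
Definition oprel (x y : nat * bool) := (y.1 < x.1)%N || (y.1 == x.1) && ~~ y.2.

Lemma oprel_trans : transitive oprel.
Proof. by move=> [a b] [c d] [e f]; rewrite /oprel /=; case: d b f => -[] []; lia. Qed.

Lemma oprelE x y : oprel x y = (y.1 <= x.1)%N && (y.2 ==> (y.1 != x.1)).
Proof. by rewrite /oprel; case: y.2; lia. Qed.

Lemma overpartitionE n s : overpartition n s =
  [&& sorted oprel s, 0 \notin unzip1 s & sumn (unzip1 s) == n]%N.
Proof.
rewrite /overpartition; set ov := all _ _.
suff -> : sorted oprel s = sorted geq (unzip1 s) && ov.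
  by case: (sorted geq _) => //=; rewrite andbA andbC.
rewrite {}/ov; elim: s => //= -[p b] s IHs /=.
have geq_trans : transitive geq by move=> u v w; lia.
rewrite (path_sortedE oprel_trans) (path_sortedE geq_trans) IHs eqxx implybT /=.
rewrite (iotaDl 1 0) all_map.
set A := all _ (iota _ _); set A' := all _ (iota _ _).
(* With p put in front, an overlined entry of the tail must differ from p and still be the first of
   its value in s; positions shift by one. *)
have -> : A' = all (fun y => y.2 ==> (y.1 != p)) s && A.
  rewrite -[s in all _ s](mkseq_nth (0%N, false)) all_map -all_predI.
  apply: eq_in_all => i; rewrite mem_iota /= => lt_i.
  rewrite /unzip1 /unzip2 !(nth_map (0%N, false)) // [p == _]eq_sym.
  by rewrite !add0n; case: (nth _ s i) => y [] //=; case: (y == p).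
have -> : all (oprel (p, b)) s
    = all (geq p) (unzip1 s) && all (fun y => y.2 ==> (y.1 != p)) s.
  by rewrite all_map -all_predI; apply: eq_all => y; rewrite oprelE.
by rewrite -!andbA; congr (_ && _); rewrite andbCA.
Qed.

(** * Enumeration by largest part *)

Section Enumeration.
Variable R : comNzRingType.
Local Notation q := (qpow R).
Local Notation opseq := (seq (nat * bool)).

(** A cardinality with values in R, witnessed by a duplicate-free list because the sequences do not
    form a finite type. *)
Definition enumerated (P : pred opseq) (c : R) :=
  exists l : seq opseq, [/\ uniq l, l =i P & (size l)%:R = c].

Lemma enumerated_ext (P Q : pred opseq) c : P =1 Q -> enumerated P c -> enumerated Q c.
Proof. by move=> PQ [l [l_uniq lP lc]]; exists l; split=> // s; rewrite lP; apply: PQ. Qed.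

Lemma enumerated0 (P : pred opseq) : P =1 xpred0 -> enumerated P 0.
Proof. by move=> P0; exists [::]; split=> // s; rewrite [RHS]P0. Qed.

Lemma enumeratedU (P Q : pred opseq) a b : (forall s, P s -> ~~ Q s) ->
  enumerated P a -> enumerated Q b -> enumerated (fun s => P s || Q s) (a + b).
Proof.
move=> PQ [l [l_uniq lP <-]] [l' [l'_uniq l'Q <-]]; exists (l ++ l'); split.
- rewrite cat_uniq l_uniq l'_uniq andbT; apply/hasPn => s; rewrite l'Q => Qs.
  by apply/negP; rewrite /= lP => /PQ/negP; apply.
- by move=> s; rewrite mem_cat lP l'Q.
by rewrite size_cat natrD.
Qed.

Lemma enumerated_cons (P : pred opseq) x c : enumerated P c ->
  enumerated (fun s => if s is y :: s' then (y == x) && P s' else false) c.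
Proof.
move=> [l [l_uniq lP <-]]; exists (map (cons x) l); split; last by rewrite size_map.
  by rewrite map_inj_uniq // => s t [].
move=> [|y s]; first by apply/mapP => -[].
apply/mapP/andP => [[t + [-> ->]]|[/eqP-> Ps]]; first by rewrite lP.
by exists s => //; rewrite lP.
Qed.

Variable S : pred nat.

Definition opart m n (s : opseq) :=
  [&& sorted oprel s, all (fun y => (0 < y.1 <= m)%N && S y.1) s & sumn (unzip1 s) == n].
(** These are the possible tails after a leading part m: any further copy of m is not overlined. *)
Definition oparth m n (s : opseq) := opart m n s && ((m, true) \notin s).

Lemma opartS m n p b s : opart m.+1 n ((p, b) :: s) =
  opart m n ((p, b) :: s) ||
  [&& p == m.+1, S m.+1, m.+1 <= n & oparth m.+1 (n - m.+1) s]%N.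
Proof.
rewrite /oparth /opart /= (path_sortedE oprel_trans).
case: (ltngtP p m.+1) => [lt_p|lt_p|->] /=.
- rewrite orbF; case: (boolP (all (oprel _) s)) => //= s_p; congr [&& _, _ && _ & _].
    congr (_ && _); rewrite ltnS in lt_p; rewrite lt_p; lia.
  apply: eq_in_all => y /(allP s_p); rewrite oprelE /= => /andP[le_y _].
  by congr (_ && _); lia.
- have -> : (p <= m)%N = false by lia.
  by rewrite !andbF.
rewrite ltnn /= !andbF ?leqnn /=; case: (S m.+1) => /=; last by rewrite !andbF.
have sumE : (m.+1 + sumn (unzip1 s) == n) = (m.+1 <= n)%N && (sumn (unzip1 s) == n - m.+1)%N.
  by lia.
rewrite sumE; case: (m.+1 <= n)%N; rewrite ?andbF //=.
case: (boolP (sorted _ s)) => //=; rewrite ?andbF // => _.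
case: (boolP (all (fun y => (0 < y.1 <= m.+1)%N && S y.1) s)) => s_le; last by rewrite !andbF.
rewrite /= andbT [RHS]andbC; congr (_ && _).
apply/allP/idP => [s_oprel|s_m [p' b'] y_s].
  by apply/negP => /s_oprel; rewrite oprelE /= eqxx andbF.
rewrite oprelE /=; have /andP[/andP[_ ->] _] := allP s_le _ y_s.
by apply/implyP => b'T; apply: contra s_m => /eqP <-; rewrite -b'T.
Qed.

Lemma oparthS m n p b s : oparth m.+1 n ((p, b) :: s) =
  opart m n ((p, b) :: s) ||
  [&& (p, b) == (m.+1, false), S m.+1, m.+1 <= n & oparth m.+1 (n - m.+1) s]%N.
Proof.
have opartN : opart m n ((p, b) :: s) -> (m.+1, true) \notin (p, b) :: s.
  move=> /and3P[_ s_le _]; apply/negP => /(allP s_le) /=.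
  by rewrite ltnn.
rewrite {1}/oparth opartS xpair_eqE.
case: (boolP (opart m n _)) => [/opartN -> //|_] /=.
rewrite inE negb_or xpair_eqE; case: eqP => //= ->; rewrite eqxx /=.
case: (S m.+1); rewrite ?andbF //=; case: (m.+1 <= n)%N; rewrite ?andbF //=.
by rewrite /oparth; case: b {opartN} => //=; rewrite ?andbF // -andbA andbb.
Qed.

(** Induction on the bound m: either m+1 does not occur, or it is the leading part and is removed by
    [opartS] or [oparthS]. *)
Lemma opart_enum m n :
  enumerated (opart m n) ((\prod_(1 <= i < m.+1) opfactor R i ^+ S i) n).
Proof.
elim: m n => [|m IHm] n.
  rewrite big_geq // coefs1; case: n => [|n].
    exists [:: [::]]; split=> // -[|[p b] s]; first by [].
    by rewrite inE [RHS](_ : _ = false) // unfold_in /opart /=; case: p => [|p]; rewrite /= ?andbF.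
  apply: enumerated0 => -[|[p b] s] //.
  by rewrite /opart /=; case: p => [|p]; rewrite /= ?andbF.
set f := \prod_(_ <= _ < _) _ in IHm.
have -> : \prod_(1 <= i < m.+2) opfactor R i ^+ S i = f * opfactor R m.+1 ^+ S m.+1.
  by rewrite big_nat_recr.
case: (boolP (S m.+1)) => [Sm|/negPf Sm]; last first.
  rewrite expr0 mulr1; apply: enumerated_ext (IHm n) => -[|[p b] s] //.
  by rewrite opartS Sm andbF orbF.
(* U = f / (1 - q^(m+1)) is to count [oparth m.+1], where all copies of m+1 are plain; [UE] removes
   one copy. *)
pose U := f * geom R m.+1.
have UE : U = f + q m.+1 * U.
  rewrite -[LHS](subrK (q m.+1 * U)); congr (_ + _).
  by rewrite /U -{1}[f * _]mul1r -mulrBl mulrCA geomK // mulr1.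
have tailE (k : nat) : enumerated (oparth m.+1 k) (U k) ->
    forall b, enumerated
      (fun s => if s is y :: s' then (y == (m.+1, b)) && oparth m.+1 k s' else false) (U k).
  by move=> Uk b; apply: enumerated_cons.
have opartN k p b s : opart m k ((p, b) :: s) -> (p == m.+1) = false.
  move/and3P=> [_ /= /andP[/andP[/andP[_ le_p] _] _] _].
  by apply/eqP => p_eq; move: le_p; rewrite p_eq ltnn.
have disj (k : nat) (Q : pred opseq) b s : opart m k s ->
    ~~ (if s is y :: s' then (y == (m.+1, b)) && Q s' else false).
  by case: s => // -[p b'] s /opartN np; rewrite xpair_eqE np.
have U_enum (k : nat) : enumerated (oparth m.+1 k) (U k).
  have [N] := ubnP k; elim: N k => // N IHN k lt_k.
  rewrite UE coefsD coefs_qpowM; case: leqP => le_k.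
    rewrite addr0; apply: enumerated_ext (IHm k) => -[|[p b] s] //.
      by rewrite /oparth andbT.
    by rewrite oparthS ltnNge le_k /= !andbF orbF.
  have lt_kN : (k - m.+1 < N)%N by lia.
  have := enumeratedU (disj _ _ _) (IHm k) (tailE _ (IHN _ lt_kN) false).
  apply: enumerated_ext => -[|[p b] s]; first by rewrite orbF /oparth andbT.
  by rewrite oparthS Sm le_k.
(* The two equal terms stand for a leading m+1 that is plain or overlined. *)
have -> : f * opfactor R m.+1 ^+ true = f + q m.+1 * U + q m.+1 * U.
  by rewrite -UE expr1 /opfactor /U; ring.
rewrite !coefsD !coefs_qpowM; case: leqP => le_n.
  rewrite !addr0; apply: enumerated_ext (IHm n) => -[|[p b] s] //.
  by rewrite opartS ltnNge le_n /= !andbF orbF.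
have h1 := enumeratedU (disj _ _ _) (IHm n) (tailE _ (U_enum (n - m.+1)%N) false).
have := enumeratedU _ h1 (tailE _ (U_enum (n - m.+1)%N) true).
move=> h2; apply: enumerated_ext (h2 _); last first.
  move=> s /orP[/disj //|]; case: s => // -[p b] s.
  by rewrite !xpair_eqE => /andP[/andP[_ /eqP ->] _]; rewrite andbF.
move=> [|[p b] s]; first by rewrite !orbF.
rewrite opartS Sm le_n !xpair_eqE; case: (opart m n _) => //=.
by case: (p == _); case: b; rewrite ?orbF.
Qed.

End Enumeration.

Lemma Bbar_opprod (R : comNzRingType) l1 l2 n :
  (Bbar l1 l2 n)%:R = opprod R (fun i => ~~ (l1 %| i)%N && ~~ (l2 %| i)%N) n.
Proof.
pose S i := ~~ (l1 %| i)%N && ~~ (l2 %| i)%N.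
have [l [l_uniq lP l_size]] := opart_enum R S n n.
rewrite [RHS](_ : _ = (size l)%:R); last by rewrite l_size.
have opartE s : opart S n n s = overpartition n s && regular l1 l2 s.
  rewrite overpartitionE /opart /regular; case: (sorted _ s) => //=.
  case: eqP => [sum_s|_]; rewrite ?andbF // !andbT all_map.
  rewrite -(has_pred1 0%N) has_map -all_predC -all_predI.
  apply: eq_in_all => -[p b] y_s /=; rewrite -/(S p) lt0n.
  (* A part is at most the sum, so bounding the parts by n loses nothing. *)
  have -> : (p <= n)%N; last by rewrite andbT.
  rewrite -sum_s; elim: s y_s {sum_s} => //= -[p' b'] s IHs; rewrite inE => /orP[/eqP[-> _]|/IHs].
    exact: leq_addr.
  by move=> /leq_trans; apply; apply: leq_addl.
congr _%:R; rewrite /Bbar cardE -(size_map (fun s : {bseq n of _} => oseq s)).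
apply/perm_size/uniq_perm => //.
  by rewrite map_inj_uniq ?enum_uniq // => s t /oseq_inj/val_inj.
move=> s; rewrite lP [RHS]opartE; apply/mapP/andP => [[t]|[s_op s_reg]].
  by rewrite mem_enum inE => /andP[? ?] ->.
have [t tE] := overpartition_bseq s_op; exists t => //.
by rewrite mem_enum inE tE s_op.
Qed.

Local Close Scope ring_scope.

Theorem theorem7p1 (n : nat) : Bbar 8 3 (36 * n + 33) = 0 %[mod 3].
Proof.
apply/eqP; rewrite mod0n -/(dvdn 3 _) (dvdn_pcharf (pchar_Fp (isT : prime 3))).
by rewrite Bbar_opprod opprod_regular83_coef.
Qed.
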